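(* Let $X$ be a set and let $\Gamma$ be a graph on $X$ such that for every $x_0\in X$ the set $\{x_1\in X\colon\{x_0,x_1\}\in\Gamma\}$ is finite. Then the finite approximation coloring poset $R(\Gamma)$ is $\langle X,\Gamma\rangle$-definably $\sigma$-Ramsey-centered: there is a sequence of Ramsey-centered subsets of $R(\Gamma)$, definable from $X$ and $\Gamma$, whose union is $R(\Gamma)$.
   Context: The finite approximation coloring poset $R(\Gamma)$ consists of all finite partial functions $p\colon X\to\omega$ such that no edge of $\Gamma$ contained in $\mathrm{dom}(p)$ is $p$-monochromatic, ordered by reverse inclusion. A set $A\subset R$ of a poset $R$ is Ramsey-centered if for every $n\in\omega$ there is $m\in\omega$ such that for every $m$-tuple $\langle r_i\colon i<m\rangle$ of elements of $A$ there is $b\subset m$ of size $n$ such that $\{r_i\colon i\in b\}$ has a common lower bound in $R$. *)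

(* Defs.v *)
From mathcomp Require Import all_boot.

Set Implicit Arguments.
Unset Strict Implicit.
Unset Printing Implicit Defensive.

(* The universe of sets is Aczel's type of well-founded trees: [Sup f] is the
   set { f a : a : A }.  It is a setoid: equality of sets is the extensional
   [Veq], not Leibniz equality. *)
Inductive V : Type := Sup (A : Type) (f : A -> V).

Fixpoint Veq (x y : V) : Prop :=
  match x, y with
  | Sup A f, Sup B g =>
      (forall a : A, exists b : B, Veq (f a) (g b)) /\
      (forall b : B, exists a : A, Veq (f a) (g b))
  end.

Definition Vin (x y : V) : Prop :=
  match y with Sup B g => exists b : B, Veq x (g b) end.

Definition Vsub (x y : V) : Prop := forall z : V, Vin z x -> Vin z y.

Definition Vempty : V := Sup (fun v : void => match v with end).

(* The unordered pair {x, y}, and Kuratowski's ordered pair {{x}, {x, y}}. *)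
Definition Vupair (x y : V) : V := Sup (fun b : bool => if b then x else y).

Definition Vpair (x y : V) : V := Vupair (Vupair x x) (Vupair x y).

(* Separation is meant only for predicates P that are invariant under [Veq]. *)
Definition Vsep (x : V) (P : V -> Prop) : V :=
  match x with Sup A f => Sup (fun a : {a : A | P (f a)} => f (proj1_sig a)) end.

Definition Vpow (x : V) : V :=
  match x with
  | Sup A f =>
      Sup (fun P : A -> Prop => Sup (fun a : {a : A | P a} => f (proj1_sig a)))
  end.

Definition Vprod (x y : V) : V :=
  match x, y with
  | Sup A f, Sup B g => Sup (fun ab : A * B => Vpair (f ab.1) (g ab.2))
  end.

(* x \cup {x} *)
Definition Vsucc (x : V) : V :=
  match x with
  | Sup A f => Sup (fun o : option A => if o is Some a then f a else x)
  end.

Fixpoint Vnat (n : nat) : V := if n is k.+1 then Vsucc (Vnat k) else Vempty.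

Definition Vomega : V := Sup Vnat.

(* The sequence (A 0, A 1, ...) as a set, that is, as a function on omega. *)
Definition Vseq (A : nat -> V) : V := Sup (fun n : nat => Vpair (Vnat n) (A n)).

Definition Vfinite (x : V) : Prop :=
  exists (n : nat) (f : 'I_n -> V), Veq x (Sup f).

(* First-order formulas of the language of set theory, with de Bruijn indices:
   variable 0 is the one bound by the innermost quantifier. *)
Inductive formula : Type :=
  | FEq (i j : nat)
  | FIn (i j : nat)
  | FFalse
  | FImp (phi psi : formula)
  | FAll (phi : formula).

(* Satisfaction in (V, Vin).  Variables outside the environment denote the empty
   set, so they do not act as additional parameters. *)
Fixpoint sat (e : seq V) (phi : formula) : Prop :=
  match phi with
  | FEq i j => Veq (nth Vempty e i) (nth Vempty e j)
  | FIn i j => Vin (nth Vempty e i) (nth Vempty e j)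
  | FFalse => False
  | FImp phi1 phi2 => sat e phi1 -> sat e phi2
  | FAll phi1 => forall x : V, sat (x :: e) phi1
  end.

Definition definable_from (params : seq V) (s : V) : Prop :=
  exists phi : formula, forall z : V, sat (z :: params) phi <-> Veq z s.

(* In what follows a poset is a set R : V together with a relation le on V, of
   which only the restriction to R matters. *)
Definition ramsey_centered (R : V) (le : V -> V -> Prop) (A : V) : Prop :=
  Vsub A R /\
  forall n : nat, exists m : nat, forall r : 'I_m -> V,
    (forall i : 'I_m, Vin (r i) A) ->
    exists b : {set 'I_m}, #|b| = n /\
      exists q : V, Vin q R /\ forall i : 'I_m, i \in b -> le q (r i).

Definition definably_sigma_ramsey_centered
    (params : seq V) (R : V) (le : V -> V -> Prop) : Prop :=
  exists A : nat -> V,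
    definable_from params (Vseq A) /\
    (forall n : nat, ramsey_centered R le (A n)) /\
    (forall p : V, Vin p R <-> exists n : nat, Vin p (A n)).

(* G is a set of two-element subsets of X. *)
Definition graph_on (X G : V) : Prop :=
  forall e : V, Vin e G ->
    exists x y : V, Vin x X /\ Vin y X /\ ~ Veq x y /\ Veq e (Vupair x y).

Definition neighbors (X G x0 : V) : V :=
  Vsep X (fun x1 : V => Vin (Vupair x0 x1) G).

Definition functional (p : V) : Prop :=
  forall x y y' : V, Vin (Vpair x y) p -> Vin (Vpair x y') p -> Veq y y'.

Definition in_dom (p x : V) : Prop := exists y : V, Vin (Vpair x y) p.

Definition monochromatic (p e : V) : Prop :=
  exists c : V, forall x : V, Vin x e -> Vin (Vpair x c) p.

Definition coloring_poset (X G : V) : V :=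
  Vsep (Vpow (Vprod X Vomega)) (fun p : V =>
    Vfinite p /\ functional p /\
    forall e : V, Vin e G -> (forall x : V, Vin x e -> in_dom p x) ->
      ~ monochromatic p e).

Definition reverse_inclusion (q p : V) : Prop := Vsub p q.

(* Main.v *)
(** The n-th piece consists of the conditions that have at most n elements, use
    colors below n, and whose domain consists of vertices of degree at most n.
    Say that two points (x, c) and (y, d) clash if x = y and c, d differ, or if
    {x, y} is an edge and c = d.  Conditions whose points do not clash pairwise
    have their union as a common lower bound.  A point clashes with at most 2n
    points of conditions in the n-th piece, so among many sets of at most n
    points, each without an inner clash, one finds k without any mutual clash.
    Local finiteness is used only to see that the pieces cover the poset. *)
From Stdlib Require Import Setoid Morphisms.
From Stdlib Require List.
Require Import Defs.
From mathcomp Require Import all_boot boolp.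

Set Implicit Arguments.
Unset Strict Implicit.
Unset Printing Implicit Defensive.

(** * Lists without decidable equality, and counting *)

(* Lists of sets use [List.In]: the universe of [V] is too large for [eqType]. *)
Lemma has_InP (T : Type) (a : pred T) (s : seq T) :
  reflect (exists2 x, List.In x s & a x) (has a s).
Proof.
elim: s => [|x s IHs] /=; first by right=> -[].
apply: (iffP orP) => [[ax|/IHs[y ys ay]]|[y [->|ys] ay]].
- by exists x => //; left.
- by exists y => //; right.
- by left.
- by right; apply/IHs; exists y.
Qed.

Lemma In_mem (T : eqType) (x : T) (s : seq T) : List.In x s <-> x \in s.
Proof.
elim: s => //= y s IHs; rewrite inE IHs; split=> [[->|->]|/orP[/eqP->|->]].
- by rewrite eqxx.
- by rewrite orbT.
- by left.
- by right.
Qed.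

Lemma In_filter (T : Type) (a : pred T) (x : T) (s : seq T) :
  List.In x (filter a s) <-> List.In x s /\ a x.
Proof. exact: List.filter_In. Qed.

Lemma In_flatten_map (S T : Type) (f : S -> seq T) (y : T) (s : seq S) :
  List.In y (flatten (map f s)) <-> exists2 x, List.In x s & List.In y (f x).
Proof.
elim: s => [|x s IHs] /=; first by split=> [|[]].
rewrite List.in_app_iff IHs; split=> [[yf|[z zs yf]]|[z [->|zs] yf]].
- by exists x => //; left.
- by exists z => //; right.
- by left.
- by right; exists z.
Qed.

Lemma leq_size_flatten_map (S T : Type) (f : S -> seq T) (s : seq S) (d : nat) :
  (forall x, List.In x s -> size (f x) <= d) -> size (flatten (map f s)) <= size s * d.
Proof.
elim: s => //= x s IHs le_d; rewrite size_cat mulSn leq_add ?le_d ?IHs //; first by left.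
by move=> y ys; apply: le_d; right.
Qed.

Lemma exists_subset_card (I : finType) (B : {set I}) (n : nat) :
  n <= #|B| -> exists2 b : {set I}, b \subset B & #|b| = n.
Proof.
move=> le_n; exists [set x in take n (enum B)].
  by apply/subsetP=> x; rewrite inE => /mem_take; rewrite mem_enum.
rewrite cardsE; have /card_uniqP-> : uniq (take n (enum B)).
  by rewrite take_uniq ?enum_uniq.
by rewrite size_takel // -cardE.
Qed.

(** By induction on [C]: if [F z] has at most [m] elements, then deleting it from [A] costs at most
    [m] elements, and the rest of [C] covers what remains. *)
Lemma pigeonhole_cover (S : Type) (I : finType) (C : seq S) (F : S -> {set I})
    (A : {set I}) (m : nat) :
  (forall i, i \in A -> exists2 z, List.In z C & i \in F z) ->
  size C * m < #|A| -> exists2 z, List.In z C & m < #|F z|.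
Proof.
elim: C A => [|z C IHC] A cover /= lt_A.
  by have /card_gt0P[i /cover[]] : 0 < #|A| by apply: leq_ltn_trans lt_A.
have [lt_m|le_m] := ltnP m #|F z|; first by exists z => //; left.
have [i||z' z'C lt_z'] := IHC (A :\: F z).
- by case/setDP=> /cover[z' [<- ->//|z'C iz' _]]; exists z'.
- have le_I := subset_leq_card (subsetIr A (F z)).
  rewrite -(ltn_add2l m) -mulSn; apply: leq_trans lt_A _.
  by rewrite -(cardsID (F z) A) leq_add2r (leq_trans le_I).
by exists z' => //; right.
Qed.

(** * Conflict-free subfamilies of short lists *)

Section BoundedConflicts.

(** [eqv] plays the role of equality of points, and [nb u] lists, up to [eqv], everything that
    conflicts with [u]. *)
Variables (T : Type) (eqv conf : rel T) (nb : T -> seq T) (D : nat).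
Hypothesis conf_sym : symmetric conf.
Hypothesis conf_eqv : forall u v w, eqv u v -> conf u w = conf v w.
Hypothesis conf_nb : forall u w, conf u w -> has (eqv w) (nb u).
Hypothesis size_nb : forall u, size (nb u) <= D.

Definition conflict (s t : seq T) : bool := has (fun u => has (conf u) t) s.

Lemma conflictP (s t : seq T) :
  reflect (exists u v, [/\ List.In u s, List.In v t & conf u v]) (conflict s t).
Proof.
apply: (iffP (has_InP _ _)).
  by case=> u us /has_InP[v vt c]; exists u, v.
by case=> u [v [us vt c]]; exists u => //; apply/has_InP; exists v.
Qed.

Lemma conflict_sym : symmetric conflict.
Proof.
suff imp s t : conflict s t -> conflict t s by move=> s t; apply/idP/idP; apply: imp.
by case/conflictP=> u [v [us vt c]]; apply/conflictP; exists v, u; rewrite conf_sym.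
Qed.

(** A copy of [z] in [s] cannot conflict with a point of [t], since [t] has its own copy of [z] and
    would then have an inner conflict; likewise with the roles exchanged. So the conflict survives
    the removal of all copies of [z]. *)
Lemma conflict_filter (z : T) (s t : seq T) :
  has (eqv^~ z) s -> has (eqv^~ z) t -> ~~ conflict s s -> ~~ conflict t t ->
  conflict s t -> conflict (filter (predC (eqv^~ z)) s) (filter (predC (eqv^~ z)) t).
Proof.
move=> /has_InP[a sa az] /has_InP[b tb bz] ns nt /conflictP[u [v [us vt c]]].
have [uz|nuz] := boolP (eqv u z).
  case/conflictP: nt; exists b, v; split=> //.
  by rewrite (conf_eqv _ bz) -(conf_eqv _ uz).
have [vz|nvz] := boolP (eqv v z).
  case/conflictP: ns; exists a, u; split=> //.
  by rewrite (conf_eqv _ az) -(conf_eqv _ vz) conf_sym.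
by apply/conflictP; exists u, v; split=> //; apply/In_filter.
Qed.

(* If a maximal conflict-free subfamily is small, then the points conflicting
   with it form a bounded set met by every other member of the family; many
   members share one of these points, which can then be removed from them. *)
Lemma conflict_free_subfamily (k n : nat) :
  exists m, forall (I : finType) (s : I -> seq T) (B : {set I}),
    (forall i, i \in B -> size (s i) <= k) ->
    (forall i, i \in B -> ~~ conflict (s i) (s i)) ->
    m <= #|B| ->
    exists2 b : {set I}, b \subset B & #|b| = n /\
      {in b &, forall i j, ~~ conflict (s i) (s j)}.
Proof.
elim: k => [|k [m IHm]].
  exists n => I s B size_s _ /exists_subset_card[b sbB cb]; exists b => //.
  split=> // i j /(subsetP sbB) iB _.
  by move: (size_s i iB); rewrite leqn0 => /nilP->.
(* Fewer than [n] lists of length at most [k.+1] meet at most [n * (k.+1 * D)] conflicting points.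
   Outside the subfamily more than [m] times as many members remain, so one point is shared by more
   than [m] of them. *)
exists (n + (n * (k.+1 * D)) * m).+1 => I s B size_s s_free le_B.
pose free (b : {set I}) :=
  (b \subset B) && [forall i in b, forall j in b, ~~ conflict (s i) (s j)].
have free0 : free set0.
  by rewrite /free sub0set; apply/forall_inP=> i; rewrite inE.
have [b /maxsetP[/andP[sbB /forall_inP b_free] b_max] _] := maxset_exists free0.
have {}b_free : {in b &, forall i j, ~~ conflict (s i) (s j)}.
  by move=> i j ib jb; move/forall_inP: (b_free i ib); apply.
have [le_nb|lt_bn] := leqP n #|b|.
  have [c scb cn] := exists_subset_card le_nb.
  exists c; first exact: subset_trans sbB.
  by split=> // i j /(subsetP scb) ? /(subsetP scb) ?; apply: b_free.
pose C := flatten [seq flatten [seq nb z | z <- s i] | i <- enum b].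
have size_C : size C <= n * (k.+1 * D).
  apply: leq_trans (_ : size (enum b) * (k.+1 * D) <= _).
    apply: leq_size_flatten_map => i /In_mem; rewrite mem_enum => /(subsetP sbB) iB.
    by apply: leq_trans (leq_size_flatten_map _) _ => //; rewrite leq_mul2r size_s ?orbT.
  by rewrite -cardE leq_mul2r (ltnW lt_bn) orbT.
pose F z := [set j in B | has (eqv^~ z) (s j)].
have C_meets j : j \in B :\: b -> exists2 z, List.In z C & j \in F z.
  case/setDP=> jB jNb.
  have [/existsP[i /andP[ib /conflictP[u [v [us vs c]]]]]|/existsPn no] :=
      boolP [exists i, (i \in b) && conflict (s i) (s j)].
    have /has_InP[z zu vz] := conf_nb c; exists z.
      apply/In_flatten_map; exists i; first by apply/In_mem; rewrite mem_enum.
      by apply/In_flatten_map; exists u.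
    by rewrite inE jB; apply/has_InP; exists v.
  have {}no i : i \in b -> ~~ conflict (s i) (s j).
    by move=> ib; move: (no i); rewrite ib.
  (* A member outside [b] without conflicts with [b] could be added to it, against maximality. *)
  suff /b_max/(_ (subsetUr _ _)) E : free (j |: b) by rewrite -E setU11 in jNb.
  rewrite /free subUset sub1set jB sbB /=.
  apply/forall_inP=> i /setU1P[->|ib]; apply/forall_inP=> l /setU1P[->|lb].
  - exact: s_free.
  - by rewrite conflict_sym no.
  - exact: no.
  - exact: b_free.
have [|z zC /ltnW le_m] := pigeonhole_cover (m := m) C_meets.
  apply: leq_ltn_trans (_ : n * (k.+1 * D) * m < _); first by rewrite leq_mul2r size_C orbT.
  rewrite -(ltn_add2l n); apply: (leq_trans le_B).
  rewrite -(cardsID b B) leq_add2r.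
  by rewrite (leq_trans (subset_leq_card (subsetIr _ _))) // ltnW.
have Fz i : i \in F z -> i \in B /\ has (eqv^~ z) (s i) by rewrite inE => /andP[].
(* Every list indexed by [F z] contains a copy of [z], so deleting the copies brings its length down
   to at most [k]. *)
have [||c scF [cn c_free]] := IHm I (fun i => filter (predC (eqv^~ z)) (s i)) (F z) _ _ le_m.
- move=> i /Fz[iB iz]; rewrite size_filter -ltnS; apply: leq_trans (size_s i iB).
  by rewrite -(count_predC (eqv^~ z) (s i)) -addn1 addnC leq_add2r -has_count.
- move=> i /Fz[iB iz]; apply: contra (s_free i iB) => /conflictP[u [v]].
  by case=> /In_filter[us _] /In_filter[vs _] c; apply/conflictP; exists u, v.
exists c; first by apply/subsetP=> i /(subsetP scF)/Fz[].
split=> // i j ic jc; apply: contra (c_free i j ic jc).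
have [/Fz[iB iz] /Fz[jB jz]] := (subsetP scF _ ic, subsetP scF _ jc).
by apply: conflict_filter => //; apply: s_free.
Qed.

End BoundedConflicts.

(** * Extensional equality and the basic set operations *)

Lemma Veq_refl (x : V) : Veq x x.
Proof. by elim: x => A f IHf; split=> a; exists a. Qed.

#[local] Hint Resolve Veq_refl : core.

Lemma Veq_sym (x y : V) : Veq x y -> Veq y x.
Proof.
elim: x y => A f IHf [B g] /= [fg gf]; split=> [b|a].
  by have [a /IHf] := gf b; exists a.
by have [b /IHf] := fg a; exists b.
Qed.

Lemma Veq_trans (x y z : V) : Veq x y -> Veq y z -> Veq x z.
Proof.
elim: x y z => A f IHf [B g] [C h] /= [fg gf] [gh hg]; split=> [a|c].
  by have [b fgb] := fg a; have [c ghc] := gh b; exists c; apply: IHf ghc.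
by have [b ghb] := hg c; have [a fga] := gf b; exists a; apply: IHf ghb.
Qed.

Lemma Vin_eql (x y z : V) : Veq x y -> Vin x z -> Vin y z.
Proof.
case: z => A f /= xy [a xa]; exists a.
exact: Veq_trans (Veq_sym xy) xa.
Qed.

Lemma Veq_ext (x y : V) : Veq x y <-> forall z, Vin z x <-> Vin z y.
Proof.
case: x y => A f [B g] /=; split=> [[fg gf] z|xy].
  split=> [[a za]|[b zb]].
    by have [b ab] := fg a; exists b; apply: Veq_trans ab.
  by have [a ab] := gf b; exists a; apply: Veq_trans zb (Veq_sym ab).
split=> [a|b].
  by apply/(xy (f a)); exists a; apply: Veq_refl.
have [_ [|a /Veq_sym]] := xy (g b); first by exists b; apply: Veq_refl.
by exists a.
Qed.

Lemma Vin_eqr (x y z : V) : Veq x y -> Vin z x -> Vin z y.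
Proof. by move/Veq_ext=> xy /xy. Qed.

#[local] Instance Veq_equivalence : Equivalence Veq.
Proof.
by split; [exact: Veq_refl | exact: Veq_sym | exact: Veq_trans].
Qed.

#[local] Instance Vin_proper : Proper (Veq ==> Veq ==> iff) Vin.
Proof.
move=> x x' xx' y y' yy'; split=> /Vin_eql xy; apply: Vin_eqr (xy _ _) => //.
exact: Veq_sym.
exact: Veq_sym.
Qed.

(** If a tree is an element of itself, it equals one of its children, which is then an element of
    itself; induction on trees excludes this. *)
Lemma Vin_irrefl (x : V) : ~ Vin x x.
Proof.
elim: x => A f IHf; case=> a fa; apply: (IHf a).
by rewrite -{2}fa; exists a; apply: Veq_refl.
Qed.

Lemma Vin_upair (z x y : V) : Vin z (Vupair x y) <-> Veq z x \/ Veq z y.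
Proof.
split=> [[[] zb]|[zx|zy]].
- by left.
- by right.
- by exists true.
- by exists false.
Qed.

Lemma Vupair_sym (x y : V) : Veq (Vupair x y) (Vupair y x).
Proof. by apply/Veq_ext=> z; rewrite !Vin_upair or_comm. Qed.

#[local] Instance Vupair_proper : Proper (Veq ==> Veq ==> Veq) Vupair.
Proof.
by move=> x x' xx' y y' yy'; apply/Veq_ext=> z; rewrite !Vin_upair xx' yy'.
Qed.

#[local] Instance Vpair_proper : Proper (Veq ==> Veq ==> Veq) Vpair.
Proof. by move=> x x' xx' y y' yy'; rewrite /Vpair xx' yy'. Qed.

Lemma Vupair_inj (x y x' y' : V) : Veq (Vupair x y) (Vupair x' y') ->
  Veq x x' /\ Veq y y' \/ Veq x y' /\ Veq y x'.
Proof.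
move/Veq_ext=> E.
have := E x; have := E y; have := E x'; have := E y'.
rewrite !Vin_upair.
move=> [_ /(_ (or_intror (Veq_refl _))) y'E] [_ /(_ (or_introl (Veq_refl _))) x'E].
move=> [/(_ (or_intror (Veq_refl _))) yE _] [/(_ (or_introl (Veq_refl _))) xE _].
(* In the two degenerate cases [x] and [y] coincide, and the remaining primed element is identified
   by [y'E] or [x'E]. *)
case: xE => xE; case: yE => yE; [|by left|by right|].
  by left; split=> //; case: y'E => -> //; rewrite yE xE.
by left; split=> //; case: x'E => -> //; rewrite yE xE.
Qed.

Lemma Vpair_inj (x y x' y' : V) :
  Veq (Vpair x y) (Vpair x' y') -> Veq x x' /\ Veq y y'.
Proof.
case/Vupair_inj=> -[/Vupair_inj E /Vupair_inj E'].
  by case: E E' => -[xx' _] [] [] // xy' yx'; split=> //; rewrite yx' -xx'.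
case: E E' => -[xx' xy'] [] [] // yx' yy'; split=> //.
all: by rewrite ?yy' ?yx' -?xy' -?xx' // ?xx' ?xy'.
Qed.

Lemma Vin_sep (z x : V) (P : V -> Prop) :
  (forall y y', Veq y y' -> P y -> P y') -> Vin z (Vsep x P) <-> Vin z x /\ P z.
Proof.
case: x => A f P_eq /=; split=> [[[a Pa] /= za]|[[a za] Pz]].
  by split; [exists a | apply: P_eq Pa; apply: Veq_sym].
by exists (exist _ a (P_eq _ _ za Pz)).
Qed.

Lemma Vin_pow (z x : V) : Vin z (Vpow x) <-> Vsub z x.
Proof.
case: x => A f; split=> [[P /Veq_ext zP] y /zP[[a Pa] /= ya]|zx]; first by exists a.
exists (fun a => Vin (f a) z); apply/Veq_ext=> y; split=> [yz|[[a az] /= ya]].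
  have [a ya] := zx y yz; have az : Vin (f a) z by rewrite -ya.
  by exists (exist _ a az).
by rewrite ya.
Qed.

Lemma Vin_prod (z x y : V) :
  Vin z (Vprod x y) <-> exists a b, [/\ Vin a x, Vin b y & Veq z (Vpair a b)].
Proof.
case: x y => A f [B g]; split=> [[[a b] zab]|[u [v [[a ua] [b vb] zuv]]]].
  by exists (f a), (g b); split=> //; [exists a | exists b]; apply: Veq_refl.
by exists (a, b); rewrite /= -ua -vb.
Qed.

Lemma Vin_pair_prod (a b x y : V) :
  Vin (Vpair a b) (Vprod x y) <-> Vin a x /\ Vin b y.
Proof.
rewrite Vin_prod; split=> [[a' [b' [xa yb /Vpair_inj[-> ->]]]] //|[xa yb]].
by exists a, b; split=> //; apply: Veq_refl.
Qed.

Lemma Vin_empty (z : V) : ~ Vin z Vempty.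
Proof. by case. Qed.

Lemma Vin_succ (z x : V) : Vin z (Vsucc x) <-> Vin z x \/ Veq z x.
Proof.
case: x => A f; split=> [[[a|] za]|[[a za]|zx]]; first by left; exists a.
- by right.
- by exists (Some a).
- by exists None.
Qed.

Lemma Vin_nat (z : V) (n : nat) : Vin z (Vnat n) <-> exists2 i, i < n & Veq z (Vnat i).
Proof.
elim: n => [|n IHn] /=; first by split=> [/Vin_empty|[]].
rewrite Vin_succ IHn; split=> [[[i lt_i zi]|zn]|[i]].
- by exists i => //; apply: ltnW.
- by exists n.
- rewrite ltnS leq_eqVlt => /orP[/eqP-> zn|lt_i zi]; first by right.
  by left; exists i.
Qed.

Lemma Vnat_sub (m n : nat) : m <= n -> Vsub (Vnat m) (Vnat n).
Proof.
by move=> le_mn z /Vin_nat[i lt_i zi]; apply/Vin_nat; exists i => //; apply: leq_trans le_mn.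
Qed.

(** For [m < n] the set [Vnat m] is an element of [Vnat n], so equality would contradict
    [Vin_irrefl]. *)
Lemma Vnat_inj (m n : nat) : Veq (Vnat m) (Vnat n) -> m = n.
Proof.
wlog lt_mn : m n / m < n.
  move=> wl E; case: (ltngtP m n) => // lt_mn; first exact: wl.
  by apply/esym/wl => //; apply: Veq_sym.
move=> E; case: (@Vin_irrefl (Vnat n)); apply: Vin_eql E _.
by apply/Vin_nat; exists m => //; apply: Veq_refl.
Qed.

Definition Vset (s : seq V) : V := Sup (fun i : 'I_(size s) => nth Vempty s i).

Lemma Vin_set (z : V) (s : seq V) :
  Vin z (Vset s) <-> exists2 y, List.In y s & Veq z y.
Proof.
elim: s => [|y s IHs]; first by split=> [[[]]|[]].
have E : Vin z (Vset (y :: s)) <-> Veq z y \/ Vin z (Vset s).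
  split=> [[[[|i] lt_i] zi]|[zy|[i zi]]]; first by left.
  - by right; exists (Ordinal (lt_i : i < size s)).
  - by exists ord0.
  - by exists (lift ord0 i).
rewrite E IHs; split=> [[zy|[x xs zx]]|[x [->|xs] zx]].
- by exists y => //; left.
- by exists x => //; right.
- by left.
- by right; exists x.
Qed.

(** * First-order definability of predicates and terms *)

(* Quantifying over the renamings [rho] makes definability stable under weakening. *)
Definition definable (P : (nat -> V) -> Prop) : Prop :=
  forall rho : nat -> nat, exists phi : formula, forall e : seq V,
    sat e phi <-> P (fun i => nth Vempty e (rho i)).

Definition tail (e : nat -> V) : nat -> V := fun i => e i.+1.

(* A definable term is represented by the formula defining its elements. *)
Definition dterm (t : (nat -> V) -> V) : Prop :=
  definable (fun e => Vin (e 0) (t (tail e))).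

Lemma definable_ext (P Q : (nat -> V) -> Prop) :
  (forall e, P e <-> Q e) -> definable Q -> definable P.
Proof.
by move=> PQ dQ rho; have [phi phiP] := dQ rho; exists phi => e; rewrite phiP PQ.
Qed.

Lemma definable_imp (P Q : (nat -> V) -> Prop) :
  definable P -> definable Q -> definable (fun e => P e -> Q e).
Proof.
move=> dP dQ rho; have [[phi phiP] [psi psiQ]] := (dP rho, dQ rho).
by exists (FImp phi psi) => e /=; rewrite phiP psiQ.
Qed.

Lemma definable_false : definable (fun=> False).
Proof. by move=> rho; exists FFalse. Qed.

Lemma definable_not (P : (nat -> V) -> Prop) :
  definable P -> definable (fun e => ~ P e).
Proof. by move=> dP; apply: definable_imp dP definable_false. Qed.

(** The language has only falsity, implication and universal quantification; the other connectives
    are encoded classically, here as [~ P -> Q]. *)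
Lemma definable_or (P Q : (nat -> V) -> Prop) :
  definable P -> definable Q -> definable (fun e => P e \/ Q e).
Proof.
move=> dP dQ; apply: definable_ext (definable_imp (definable_not dP) dQ) => e.
split=> [[]//|nPQ]; have [|nP] := pselect (P e); [by left | by right; apply: nPQ].
Qed.

Lemma definable_and (P Q : (nat -> V) -> Prop) :
  definable P -> definable Q -> definable (fun e => P e /\ Q e).
Proof.
move=> dP dQ.
apply: definable_ext (definable_not (definable_imp dP (definable_not dQ))) => e.
split=> [[p q] /(_ p)//|nPQ]; split; apply: contrapT => n; exact: nPQ.
Qed.

Lemma definable_iff (P Q : (nat -> V) -> Prop) :
  definable P -> definable Q -> definable (fun e => P e <-> Q e).
Proof. by move=> dP dQ; apply: definable_and; apply: definable_imp. Qed.

Lemma definable_forall (P : V -> (nat -> V) -> Prop) :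
  definable (fun e => P (e 0) (tail e)) -> definable (fun e => forall x, P x e).
Proof.
(* Under the quantifier the renaming fixes the new variable 0 and shifts all others by one. *)
move=> dP rho; have [phi phiP] := dP (fun i => if i is j.+1 then (rho j).+1 else 0).
by exists (FAll phi) => e /=; split=> Px x; apply/(phiP (x :: e)); apply: Px.
Qed.

Lemma definable_exists (P : V -> (nat -> V) -> Prop) :
  definable (fun e => P (e 0) (tail e)) -> definable (fun e => exists x, P x e).
Proof.
move=> dP.
apply: (@definable_ext _ (fun e => ~ forall x, ~ P x e)) => [e|].
  split=> [[x Px] /(_ x)//|nP]; apply: contrapT => n; apply: nP => x Px.
  by apply: n; exists x.
by apply: definable_not; apply: definable_forall; apply: definable_not.
Qed.

Lemma dterm_var (i : nat) : dterm (fun e => e i).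
Proof. by move=> rho; exists (FIn (rho 0) (rho i.+1)). Qed.

(** Under quantifiers a term [t] is evaluated at iterated tails of the environment; these are
    renamings, along which definability of [t] is transported. *)
Definition renaming (s : (nat -> V) -> nat -> V) : Prop :=
  exists r : nat -> nat, s = (fun e i => e (r i)).

Lemma renaming_id : renaming id.
Proof. by exists id. Qed.

Lemma renaming_tail (s : (nat -> V) -> nat -> V) :
  renaming s -> renaming (fun e => tail (s e)).
Proof. by case=> r ->; exists (fun i => r i.+1). Qed.

Lemma dterm_rename (s : (nat -> V) -> nat -> V) (t : (nat -> V) -> V) :
  renaming s -> dterm t -> dterm (fun e => t (s e)).
Proof.
by case=> r -> dt rho; exact: dt (fun i => if i is j.+1 then rho (r j).+1 else rho 0).
Qed.

Lemma dterm_weaken (t : (nat -> V) -> V) : dterm t -> dterm (fun e => t (tail e)).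
Proof. exact: dterm_rename (renaming_tail renaming_id). Qed.

Lemma definable_eq (t u : (nat -> V) -> V) :
  dterm t -> dterm u -> definable (fun e => Veq (t e) (u e)).
Proof.
move=> dt du; apply: definable_ext (fun e => Veq_ext (t e) (u e)) _.
by apply: definable_forall; apply: definable_iff.
Qed.

(** A definable term only provides membership of a variable, so the value of [t] is first named by
    an existential quantifier. *)
Lemma definable_in (t u : (nat -> V) -> V) :
  dterm t -> dterm u -> definable (fun e => Vin (t e) (u e)).
Proof.
move=> dt du.
apply: (@definable_ext _ (fun e => exists x, Veq x (t e) /\ Vin x (u e))) => [e|].
  by split=> [tu|[x [-> //]]]; exists (t e).
apply: definable_exists; apply: definable_and du; apply: definable_eq.
  exact: dterm_var.
exact: dterm_weaken.
Qed.

Lemma sat_Veq (phi : formula) (e e' : seq V) :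
  (forall i, Veq (nth Vempty e i) (nth Vempty e' i)) -> sat e phi <-> sat e' phi.
Proof.
elim: phi e e' => [i j|i j||phi IHphi psi IHpsi|phi IHphi] e e' ee' //=.
- by rewrite !ee'.
- by rewrite !ee'.
- by rewrite (IHphi _ _ ee') (IHpsi _ _ ee').
- have E x : sat (x :: e) phi <-> sat (x :: e') phi by apply: IHphi => -[|i] /=.
  by split=> phi_e x; apply/E.
Qed.

(** Formulas cannot tell [Veq]-equal sets apart, so definability also serves as a proof of
    extensionality, for instance when separating by a complex predicate. *)
Lemma definable_Veq (P : (nat -> V) -> Prop) (e e' : seq V) :
  definable P -> (forall i, Veq (nth Vempty e i) (nth Vempty e' i)) ->
  P (nth Vempty e) -> P (nth Vempty e').
Proof.
move=> /(_ id)[phi phiP] ee' Pe; apply/phiP/(sat_Veq phi ee').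
exact/phiP.
Qed.

Lemma dterm_Veq (t : (nat -> V) -> V) (e e' : seq V) :
  dterm t -> (forall i, Veq (nth Vempty e i) (nth Vempty e' i)) ->
  Veq (t (nth Vempty e)) (t (nth Vempty e')).
Proof.
move=> dt ee'; apply/Veq_ext=> z.
split=> tz; [apply: (definable_Veq (e := z :: e) (e' := z :: e') dt) tz
            |apply: (definable_Veq (e := z :: e') (e' := z :: e) dt) tz].
  by case=> //= i.
by case=> //= i; apply: Veq_sym.
Qed.

Lemma dterm_ext (t : (nat -> V) -> V) (P : V -> (nat -> V) -> Prop) :
  (forall z e, Vin z (t e) <-> P z e) -> definable (fun e => P (e 0) (tail e)) -> dterm t.
Proof. by move=> tP; apply: definable_ext => e; apply: tP. Qed.

Lemma dterm_empty : dterm (fun=> Vempty).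
Proof.
by apply: (@dterm_ext _ (fun _ _ => False)) definable_false => z e; split=> [/Vin_empty|[]].
Qed.

Lemma dterm_upair (t u : (nat -> V) -> V) :
  dterm t -> dterm u -> dterm (fun e => Vupair (t e) (u e)).
Proof.
move=> dt du; apply: dterm_ext => [z e|]; first exact: Vin_upair.
by apply: definable_or; apply: definable_eq;
  (exact: dterm_var || exact: dterm_weaken).
Qed.

Lemma dterm_pair (t u : (nat -> V) -> V) :
  dterm t -> dterm u -> dterm (fun e => Vpair (t e) (u e)).
Proof. by move=> dt du; apply: dterm_upair; apply: dterm_upair. Qed.

Lemma dterm_succ (t : (nat -> V) -> V) : dterm t -> dterm (fun e => Vsucc (t e)).
Proof.
move=> dt; apply: dterm_ext => [z e|]; first exact: Vin_succ.
by apply: (definable_or dt); apply: definable_eq; [exact: dterm_var | exact: dterm_weaken].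
Qed.

(* Dispatching on the head symbol prevents the rules for [definable] from
   unfolding [dterm], which would loop. *)
Ltac definability :=
  repeat first
    [ assumption
    | lazymatch goal with
      | |- definable _ => first
          [ exact: definable_false | apply: definable_eq | apply: definable_in
          | apply: definable_iff | apply: definable_and | apply: definable_or
          | apply: definable_not | apply: definable_imp
          | apply: definable_forall | apply: definable_exists ]
      | |- dterm _ => first
          [ exact: dterm_var | exact: dterm_empty
          | apply: dterm_succ | apply: dterm_pair | apply: dterm_upair
          | match goal with
            |- dterm (fun e => ?t (@?s e)) =>
              apply: (@dterm_rename s t); [solve [repeat apply renaming_tail; apply renaming_id]|]
            end ]
      end ].

(** Omega is the intersection of all inductive sets; it is inductive itself, which gives one
    direction, and induction on [n] gives the other. *)
Lemma dterm_omega : dterm (fun=> Vomega).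
Proof.
apply: (@dterm_ext _ (fun z _ => forall w, Vin Vempty w /\ (forall x, Vin x w -> Vin (Vsucc x) w) ->
  Vin z w)) => [z _|]; last by definability.
split=> [[n zn] w [w0 wS]|z_in].
  by rewrite zn; elim: n {zn} => //= n /wS.
apply: z_in; split; first by exists 0.
move=> x [n xn]; exists n.+1; apply/Veq_ext=> y.
by rewrite /= !Vin_succ xn.
Qed.

Lemma dterm_pow (t : (nat -> V) -> V) : dterm t -> dterm (fun e => Vpow (t e)).
Proof.
move=> dt; apply: dterm_ext => [z e|]; first exact: Vin_pow.
by rewrite /Vsub; definability.
Qed.

Lemma dterm_prod (t u : (nat -> V) -> V) :
  dterm t -> dterm u -> dterm (fun e => Vprod (t e) (u e)).
Proof.
move=> dt du.
apply: (@dterm_ext _ (fun z e => exists a b, Vin a (t e) /\ Vin b (u e) /\ Veq z (Vpair a b)))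
  => [z e|]; last by definability.
rewrite Vin_prod; split=> -[a [b]]; first by case=> ? ? ?; exists a, b.
by case=> ? [? ?]; exists a, b.
Qed.

Lemma dterm_sep (t : (nat -> V) -> V) (P : V -> (nat -> V) -> Prop) :
  dterm t -> definable (fun e => P (e 0) (tail e)) ->
  dterm (fun e => Vsep (t e) (fun z => P z e)).
Proof.
move=> dt dP rho; have [phi phiP] := definable_and dt dP rho.
exists phi => e; rewrite phiP Vin_sep // => y y' yy'.
(* [Vin_sep] requires [P] to respect [Veq]. This follows from a formula for [P] with the separated
   element at index 0; index 0 of [rho] belongs to the element variable of the term, hence
   [rho j.+1]. *)
have [psi psiP] := dP (fun i => if i is j.+1 then (rho j.+1).+1 else 0).
move=> /(psiP (y :: e)); rewrite (@sat_Veq psi _ (y' :: e)) => [/psiP//|].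
by case.
Qed.

(** * The pieces and the definability of their sequence *)

(* For v = n in omega this says that s has at most n elements, in a form that is
   visibly first-order. *)
Definition bounded (v s : V) : Prop :=
  exists f : V, functional f /\
    forall y : V, Vin y s -> exists i : V, Vin i v /\ Vin (Vpair i y) f.

Definition proper_coloring (G p : V) : Prop :=
  forall e : V, Vin e G -> (forall x : V, Vin x e -> in_dom p x) -> ~ monochromatic p e.

Definition piece_pred (X G v p : V) : Prop :=
  bounded v p /\ functional p /\ proper_coloring G p /\
  forall x : V, in_dom p x -> bounded v (neighbors X G x).

(** The index is a set rather than a number, so that a single formula, quantifying [v] over
    [Vomega], describes the whole sequence. *)
Definition piece (X G v : V) : V := Vsep (Vpow (Vprod X v)) (piece_pred X G v).

Lemma definable_bounded (t u : (nat -> V) -> V) :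
  dterm t -> dterm u -> definable (fun e => bounded (t e) (u e)).
Proof. by move=> dt du; rewrite /bounded /functional; definability. Qed.

Lemma definable_functional (t : (nat -> V) -> V) :
  dterm t -> definable (fun e => functional (t e)).
Proof. by move=> dt; rewrite /functional; definability. Qed.

Lemma definable_proper_coloring (t u : (nat -> V) -> V) :
  dterm t -> dterm u -> definable (fun e => proper_coloring (t e) (u e)).
Proof. by move=> dt du; rewrite /proper_coloring /in_dom /monochromatic; definability. Qed.

Lemma dterm_neighbors (t u v : (nat -> V) -> V) :
  dterm t -> dterm u -> dterm v -> dterm (fun e => neighbors (t e) (u e) (v e)).
Proof.
move=> dt du dv.
by apply: (dterm_sep (P := fun z e => Vin (Vupair (v e) z) (u e))); definability.
Qed.

Lemma definable_piece_pred (t u v w : (nat -> V) -> V) :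
  dterm t -> dterm u -> dterm v -> dterm w ->
  definable (fun e => piece_pred (t e) (u e) (v e) (w e)).
Proof.
move=> dt du dv dw; rewrite /piece_pred.
apply: definable_and; first exact: definable_bounded.
apply: definable_and; first exact: definable_functional.
apply: definable_and; first exact: definable_proper_coloring.
apply: definable_forall; apply: definable_imp; first by rewrite /in_dom; definability.
apply: definable_bounded; first exact: dterm_weaken.
by apply: dterm_neighbors; definability.
Qed.

Lemma dterm_piece (t u v : (nat -> V) -> V) :
  dterm t -> dterm u -> dterm v -> dterm (fun e => piece (t e) (u e) (v e)).
Proof.
move=> dt du dv.
apply: (dterm_sep (P := fun p e => piece_pred (t e) (u e) (v e) p)).
  by apply: dterm_pow; apply: dterm_prod.
apply: (definable_piece_pred (t := fun e => t (tail e)) (u := fun e => u (tail e))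
  (v := fun e => v (tail e)) (w := fun e => e 0)); definability.
Qed.

Lemma definable_pieces (X G : V) :
  definable_from [:: X; G] (Vseq (fun n => piece X G (Vnat n))).
Proof.
have dQ : definable (fun e => forall y, Vin y (e 0) <->
    exists v, Vin v Vomega /\ Veq y (Vpair v (piece (e 1) (e 2) v))).
  apply: definable_forall; apply: definable_iff; first by definability.
  apply: definable_exists; apply: definable_and.
    by apply: definable_in; [exact: dterm_var | exact: dterm_omega].
  apply: definable_eq; first by definability.
  apply: dterm_pair; first by definability.
  by apply: dterm_piece; definability.
have [phi phiP] := dQ id; exists phi => z; rewrite phiP /= Veq_ext.
suff E y : (exists v, Vin v Vomega /\ Veq y (Vpair v (piece X G v))) <->
    Vin y (Vseq (fun n => piece X G (Vnat n))).
  by split=> H y; [rewrite -E | rewrite E]; apply: H.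
split=> [[v [[n vn] ->]]|[n yn]]; last first.
  by exists (Vnat n); split=> //; exists n.
(* An element [v] of omega is only [Veq] to some [Vnat n]; the pair, being a definable term,
   respects this equality. *)
exists n; have dv : dterm (fun e => Vpair (e 0) (piece (e 1) (e 2) (e 0))).
  by apply: dterm_pair; [definability|apply: dterm_piece; definability].
by apply: (dterm_Veq (e := [:: v; X; G]) (e' := [:: Vnat n; X; G]) dv); case.
Qed.

(** * Membership in the pieces and the poset; bounds expressed by lists *)

Lemma Vin_neighbors (X G x y : V) :
  Vin y (neighbors X G x) <-> Vin y X /\ Vin (Vupair x y) G.
Proof. by apply: Vin_sep => z z' zz'; rewrite zz'. Qed.

Lemma Vin_piece (X G v p : V) : Vin p (piece X G v) <->
  Vsub p (Vprod X v) /\ piece_pred X G v p.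
Proof.
rewrite Vin_sep ?Vin_pow // => y y' yy'.
have dP : definable (fun e => piece_pred (e 1) (e 2) (e 3) (e 0)).
  by apply: definable_piece_pred; definability.
by apply: (definable_Veq (e := [:: y; X; G; v]) (e' := [:: y'; X; G; v]) dP); case.
Qed.

Lemma Vin_coloring_poset (X G p : V) : Vin p (coloring_poset X G) <->
  [/\ Vsub p (Vprod X Vomega), Vfinite p, functional p & proper_coloring G p].
Proof.
rewrite Vin_sep ?Vin_pow; first by split=> [[? [? []]]|[]].
(* [Vfinite] is not given by a formula, so its invariance is checked directly; the other two
   conditions go through definability. *)
move=> q r qr [[n [f qf]] qP]; split; first by exists n, f; rewrite -qr.
have dP : definable (fun e => functional (e 0) /\ proper_coloring (e 1) (e 0)).
  by apply: definable_and; [apply: definable_functional|apply: definable_proper_coloring];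
    definability.
by apply: (definable_Veq (e := [:: q; G]) (e' := [:: r; G]) dP) qP; case.
Qed.

(** Reading off the values of [f] at the numbers below [n] gives the list. It only covers [s]: it
    may contain values outside [s], and [Vempty] where [f] is undefined. *)
Lemma bounded_listP (n : nat) (s : V) :
  bounded (Vnat n) s <->
  exists l : seq V, size l <= n /\ forall y, Vin y s -> exists2 z, List.In z l & Veq y z.
Proof.
split=> [[f [ff sf]]|[l [le_n sl]]].
  have /choice[g gP] (i : nat) : exists z, forall y, Vin (Vpair (Vnat i) y) f -> Veq y z.
    have [[z zf]|no] := pselect (exists z, Vin (Vpair (Vnat i) z) f).
      by exists z => y /ff; apply.
    by exists Vempty => y yf; case: no; exists y.
  exists (map g (iota 0 n)); split=> [|y ys]; first by rewrite size_map size_iota.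
  have [i [/Vin_nat[j lt_j ij]]] := sf y ys; rewrite ij => /gP yg.
  by exists (g j) => //; apply: List.in_map; apply/In_mem; rewrite mem_iota.
exists (Sup (fun i : 'I_(size l) => Vpair (Vnat i) (nth Vempty l i))).
split=> [x y y' [i /Vpair_inj[xi yi]] [j /Vpair_inj[xj yj]]|y /sl/Vin_set[i yi]].
  suff -> : Veq y (nth Vempty l j) by apply: Veq_sym.
  by have <- : i = j by apply: val_inj; apply: Vnat_inj; rewrite -xi -xj.
exists (Vnat i); split; first by apply/Vin_nat; exists i; rewrite // (leq_trans _ le_n).
by exists i; rewrite yi.
Qed.

Lemma bounded_sub (m n : nat) (s : V) :
  m <= n -> bounded (Vnat m) s -> bounded (Vnat n) s.
Proof.
move=> le_mn [f [ff sf]]; exists f; split=> // y /sf[i [im iy]].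
by exists i; split=> //; apply: Vnat_sub im.
Qed.

Lemma Vfinite_bounded (s : V) : Vfinite s <-> exists n, bounded (Vnat n) s.
Proof.
split=> [[n [f sf]]|[n /bounded_listP[l [_ sl]]]].
  exists n; apply/bounded_listP; exists (map f (enum 'I_n)).
  split=> [|y]; first by rewrite size_map size_enum_ord.
  rewrite sf => -[i yi]; exists (f i) => //.
  by apply: List.in_map; apply/In_mem; rewrite mem_enum.
(* The covering list is cut down to the elements of [s], so that it enumerates [s] exactly. *)
pose l' := filter (fun y => `[< Vin y s >]) l.
exists (size l'), (fun i => nth Vempty l' i).
apply/Veq_ext=> z; rewrite -[Sup _]/(Vset l') Vin_set; split.
  move=> zs; have [y yl zy] := sl z zs.
  by exists y => //; apply/In_filter; split=> //; apply/asboolP; rewrite -zy.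
by case=> y /In_filter[_ /asboolP ys] ->.
Qed.

Lemma graph_on_in (X G x y : V) : graph_on X G -> Vin (Vupair x y) G -> Vin x X /\ Vin y X.
Proof.
move=> hG /hG[a [b [aX [bX [_ E]]]]].
suff imp z : Vin z (Vupair x y) -> Vin z X.
  by split; apply: imp; apply/Vin_upair; [left | right].
by rewrite E Vin_upair => -[->|->].
Qed.

(** * Clashing points and Ramsey-centeredness of the pieces *)

Section Conflict.

Variables (X G : V) (n : nat).
Hypothesis hG : graph_on X G.

Definition admissible (u : V) : Prop :=
  exists x c, [/\ Veq u (Vpair x c), Vin c (Vnat n) & bounded (Vnat n) (neighbors X G x)].

Definition clash (u v : V) : Prop :=
  exists x c y d, [/\ Veq u (Vpair x c), Veq v (Vpair y d) &
    Veq x y /\ ~ Veq c d \/ Vin (Vupair x y) G /\ Veq c d].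

(** Clashes count only between points that may occur in the n-th piece; without bounds on colors and
    degrees a point could clash with infinitely many others. *)
Definition incompatible (u v : V) : bool :=
  `[< [/\ admissible u, admissible v & clash u v] >].

Lemma incompatible_sym : symmetric incompatible.
Proof.
suff imp u v : incompatible u v -> incompatible v u by move=> u v; apply/idP/idP; apply: imp.
case/asboolP=> au av [x [c [y [d [uxc vyd xcyd]]]]]; apply/asboolP; split=> //.
exists y, d, x, c; split=> //.
case: xcyd => -[xy cd]; [left | right]; split; try exact: Veq_sym.
  by move=> dc; apply: cd; apply: Veq_sym.
by rewrite Vupair_sym.
Qed.

Lemma incompatible_eqv (u v w : V) :
  `[< Veq u v >] -> incompatible u w = incompatible v w.
Proof.
move=> /asboolP uv; apply/asbool_equiv_eq.
suff imp a b : Veq a b -> [/\ admissible a, admissible w & clash a w] ->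
    [/\ admissible b, admissible w & clash b w].
  by split; apply: imp => //; apply: Veq_sym.
move=> ab [[x [c [axc cn xb]]] aw [x' [c' [y [d [axc' wyd h]]]]]]; split=> //.
  by exists x, c; split=> //; rewrite -ab.
by exists x', c', y, d; split=> //; rewrite -ab.
Qed.

Lemma incompatible_bounded (u : V) :
  exists l : seq V, size l <= n + n /\
    forall v, incompatible u v -> has (fun w => `[< Veq v w >]) l.
Proof.
have [[x [c [uxc cn /bounded_listP[l [size_l xl]]]]]|nau] := pselect (admissible u); last first.
  by exists [::]; split=> // v /asboolP[].
(* The [n] points over the same vertex cover the clashes of functionality, and the neighbors with
   the same color cover the monochromatic edges. *)
exists (map (fun i => Vpair x (Vnat i)) (iota 0 n) ++ map (fun y => Vpair y c) l).
split; first by rewrite size_cat !size_map size_iota leq_add2l.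
move=> v /asboolP[_ [y' [d' [vyd' d'n _]]] [x0 [c0 [y [d [uxc0 vyd xcyd]]]]]].
have [xx0 cc0] : Veq x x0 /\ Veq c c0 by apply: Vpair_inj; rewrite -uxc.
have [yy' dd'] : Veq y y' /\ Veq d d' by apply: Vpair_inj; rewrite -vyd.
apply/has_InP; case: xcyd => -[xy cd].
  move: d'n; rewrite -dd' => /Vin_nat[i lt_i di].
  exists (Vpair x (Vnat i)); last by apply/asboolP; rewrite vyd di xx0 xy.
  apply/List.in_app_iff; left.
  by apply: (List.in_map (fun i => Vpair x (Vnat i))); apply/In_mem; rewrite mem_iota.
have /xl[z zl yz] : Vin y (neighbors X G x).
  by rewrite Vin_neighbors xx0; split=> //; have [] := graph_on_in hG xy.
exists (Vpair z c); last by apply/asboolP; rewrite vyd yz cc0 cd.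
apply/List.in_app_iff; right.
exact: (List.in_map (fun y => Vpair y c)).
Qed.

Lemma piece_admissible (p x c : V) :
  Vin p (piece X G (Vnat n)) -> Vin (Vpair x c) p -> admissible (Vpair x c).
Proof.
case/Vin_piece=> pX [_ [_ [_ p_bounded]]] xcp; exists x, c; split=> //.
  by have /Vin_pair_prod[] := pX _ xcp.
by apply: p_bounded; exists c.
Qed.

Lemma functional_no_clash (p : V) : functional p -> proper_coloring G p ->
  forall u v, Vin u p -> Vin v p -> ~ clash u v.
Proof.
move=> p_fun p_proper u v up vp [x [c [y [d [uxc vyd]]]]].
move: up vp; rewrite uxc vyd => xcp ydp [[xy]|[xyG cd]].
  by apply; apply: (p_fun x) => //; rewrite xy.
move: ydp; rewrite -cd => ycp; apply: (p_proper _ xyG).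
  by move=> z /Vin_upair[] zE; exists c; rewrite zE.
by exists c => z /Vin_upair[->|->].
Qed.

(** Edges have two vertices, so both requirements concern only pairs of points. This allows a union
    of conditions to be checked pairwise. *)
Lemma no_clash_functional (p : V) :
  (forall u v, Vin u p -> Vin v p -> ~ clash u v) -> functional p /\ proper_coloring G p.
Proof.
move=> p_clash; split=> [x y y' xyp xyp'|e eG _ [c ec]].
  by apply: contrapT => nyy'; apply: (p_clash _ _ xyp xyp'); exists x, y, x, y'; split=> //; left.
have [x [y [_ [_ [_ exy]]]]] := hG eG.
have xcp : Vin (Vpair x c) p by apply: ec; rewrite exy Vin_upair; left.
have ycp : Vin (Vpair y c) p by apply: ec; rewrite exy Vin_upair; right.
apply: (p_clash _ _ xcp ycp); exists x, c, y, c; split=> //; right.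
by rewrite -exy.
Qed.

Lemma piece_sub : Vsub (piece X G (Vnat n)) (coloring_poset X G).
Proof.
move=> p /Vin_piece[pX [p_bounded [p_fun [p_proper _]]]].
apply/Vin_coloring_poset; split=> //; last by apply/Vfinite_bounded; exists n.
move=> z /pX/Vin_prod[x [c [xX /Vin_nat[i _ ci] zxc]]].
by apply/Vin_prod; exists x, c; split=> //; exists i.
Qed.

Lemma piece_list (p : V) : Vin p (piece X G (Vnat n)) ->
  exists l : seq V, size l <= n /\ Veq p (Vset l).
Proof.
case/Vin_piece=> _ [/bounded_listP[l [size_l pl]] _].
exists (filter (fun y => `[< Vin y p >]) l); split.
  by rewrite size_filter; apply: leq_trans size_l; apply: count_size.
apply/Veq_ext=> z; rewrite Vin_set; split=> [zp|[y /In_filter[_ /asboolP yp] ->//]].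
have [y yl zy] := pl z zp; exists y => //; apply/In_filter; split=> //.
by apply/asboolP; rewrite -zy.
Qed.

Lemma piece_ramsey_centered :
  ramsey_centered (coloring_poset X G) reverse_inclusion (piece X G (Vnat n)).
Proof.
split=> [|k]; first exact: piece_sub.
have /choice[nb nbP] := incompatible_bounded.
(* Here [n] bounds the lengths of the lists, [k] is the desired size of the subfamily, and [D] is
   [n + n]. *)
have [m mP] := conflict_free_subfamily incompatible_sym incompatible_eqv
  (fun u w => (nbP u).2 w) (fun u => (nbP u).1) n k.
exists m => r rA; have /choice[l lP] (i : 'I_m) := piece_list (rA i).
have r_in i u : List.In u (l i) -> Vin u (r i).
  by move=> ul; rewrite (lP i).2; apply/Vin_set; exists u.
have r_poset i : Vin (r i) (coloring_poset X G) by apply: piece_sub.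
have [|i _||b _ [cb b_free]] := mP _ l setT.
- by move=> i _; have [] := lP i.
- apply/negP=> /conflictP[u [v [/r_in up /r_in vp /asboolP[_ _]]]].
  by have /Vin_coloring_poset[_ _ p_fun p_proper] := r_poset i; apply: functional_no_clash up vp.
- by rewrite cardsT card_ord.
(* The common lower bound is the union of the chosen conditions. *)
exists b; split=> //; pose q := Vset (flatten (map l (enum b))).
have in_q z : Vin z q <-> exists2 i, i \in b & Vin z (r i).
  rewrite Vin_set; split=> [[y /In_flatten_map[i /In_mem ib /r_in yr] zy]|[i ib]].
    by exists i; rewrite ?zy // -mem_enum.
  rewrite (lP i).2 => /Vin_set[y yl zy]; exists y => //.
  by apply/In_flatten_map; exists i => //; apply/In_mem; rewrite mem_enum.
exists q; split=> [|i ib z zr]; last by apply/in_q; exists i.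
have q_sub : Vsub q (Vprod X Vomega).
  by move=> z /in_q[i _]; have /Vin_coloring_poset[rX _ _ _] := r_poset i; apply: rX.
have [q_fun q_proper] : functional q /\ proper_coloring G q.
  apply: no_clash_functional => u v /in_q[i ib ui] /in_q[j jb vj] uv.
  case/conflictP: (b_free i j ib jb).
  move: (ui) (vj); rewrite {1}(lP i).2 {1}(lP j).2 => /Vin_set[u' u'l uu'] /Vin_set[v' v'l vv'].
  exists u', v'; split=> //.
  (* The listed points [u'] and [v'] are only [Veq] to [u] and [v]. Replacement works in the first
     argument, so symmetry is used to reach the second. *)
  rewrite -(@incompatible_eqv u); last exact/asboolP.
  rewrite incompatible_sym -(@incompatible_eqv v); last exact/asboolP.
  rewrite incompatible_sym; apply/asboolP.
  have adm w h : Vin w (r h) -> admissible w.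
    move=> wr; have /Vin_piece[rX _] := rA h.
    have /Vin_prod[x [c [_ _ wxc]]] := rX _ wr.
    have {}wr : Vin (Vpair x c) (r h) by rewrite -wxc.
    have [x' [c' [E ? ?]]] := piece_admissible (rA h) wr.
    by exists x', c'; split=> //; apply: Veq_trans E.
  by split=> //; [apply: adm ui | apply: adm vj].
apply/Vin_coloring_poset; split=> //.
by exists (size (flatten (map l (enum b)))), (fun i => nth Vempty (flatten (map l (enum b))) i).
Qed.

End Conflict.

(** * Covering the poset by the pieces *)

Lemma uniform_bound (k : nat) (P : 'I_k -> nat -> Prop) :
  (forall i m n, m <= n -> P i m -> P i n) -> (forall i, exists n, P i n) ->
  exists n, forall i, P i n.
Proof.
move=> P_mono /choice[f fP]; exists (\max_i f i) => i.
exact: P_mono (leq_bigmax i) (fP i).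
Qed.

Lemma coloring_poset_piece (X G p : V) :
  (forall x0 : V, Vin x0 X -> Vfinite (neighbors X G x0)) ->
  Vin p (coloring_poset X G) -> exists n, Vin p (piece X G (Vnat n)).
Proof.
move=> hfin /Vin_coloring_poset[pX p_fin p_fun p_proper].
have [k [f pf]] := p_fin; have [m p_bounded] := (Vfinite_bounded p).1 p_fin.
pose P (i : 'I_k) (n : nat) := exists x c, [/\ Veq (f i) (Vpair x c), Vin x X, Vin c (Vnat n) &
  bounded (Vnat n) (neighbors X G x)].
have [|i|n nP] := @uniform_bound k P.
- move=> i a b le_ab [x [c [fxc xX cn xb]]]; exists x, c; split=> //.
    exact: Vnat_sub cn.
  exact: bounded_sub xb.
- have /pX/Vin_prod[x [c [xX [j cj] fxc]]] : Vin (f i) p by rewrite pf; exists i.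
  have [d xd] := (Vfinite_bounded _).1 (hfin x xX).
  (* The color [j] lies below [j.+1], and [d] bounds the degree of [x]. *)
  exists (maxn j.+1 d), x, c; split=> //; last exact: bounded_sub (leq_maxr _ _) xd.
  by apply/Vin_nat; exists j => //; exact: leq_maxl.
(* [m] bounds the number of elements of [p], and [n] bounds all its colors and the degrees in its
   domain. *)
exists (maxn m n); apply/Vin_piece.
have pP z : Vin z p -> exists x c, [/\ Veq z (Vpair x c), Vin x X, Vin c (Vnat n) &
    bounded (Vnat n) (neighbors X G x)].
  rewrite pf => -[i zi]; have [x [c [fxc xX cn xb]]] := nP i.
  by exists x, c; split=> //; rewrite zi.
have le_n := leq_maxr m n.
split=> [z /pP[x [c [zxc xX cn _]]]|].
  by apply/Vin_prod; exists x, c; split=> //; apply: Vnat_sub cn.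
split; first exact: bounded_sub (leq_maxl m n) p_bounded.
do 2!split=> //; move=> x [c /pP[x' [c' [/Vpair_inj[xx' _] _ _ x'b]]]].
apply: bounded_sub le_n _.
have dP : definable (fun e => bounded (e 3) (neighbors (e 1) (e 2) (e 0))).
  by apply: definable_bounded; last apply: dterm_neighbors; definability.
apply: (definable_Veq (e := [:: x'; X; G; Vnat n]) (e' := [:: x; X; G; Vnat n]) dP) x'b.
by case=> //=; apply: Veq_sym.
Qed.

Theorem theorem3p7 (X G : V) (hG : graph_on X G)
    (hfin : forall x0 : V, Vin x0 X -> Vfinite (neighbors X G x0)) :
  definably_sigma_ramsey_centered [:: X; G] (coloring_poset X G)
    reverse_inclusion.
Proof.
exists (fun n => piece X G (Vnat n)).
split; first exact: definable_pieces.
split=> [n|p]; first exact: piece_ramsey_centered.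
split=> [|[n]]; first exact: coloring_poset_piece.
exact: piece_sub.
Qed.
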